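(* Let $q=a+v\in\mathbb{H}_{\mathbb R}$ (scalar part $a$, vector part $v$) with $a>0$, and let $z\in\mathbb{C}$ with $|z|\le 1$. Then $$(1+z)^q=\sum_{j=0}^\infty\binom{q}{j}z^j .$$
   Context: $\mathbb{H}_{\mathbb R}$ is the real quaternion algebra with basis $1,e_1,e_2,e_3$ ($e_1^2=e_2^2=e_3^2=-1$, $e_1e_2=e_3$, $e_2e_3=e_1$, $e_3e_1=e_2$), and $\mathbb{H}_{\mathbb C}$ is its complexification (complex coefficients; the complex unit $i$ commutes with $e_1,e_2,e_3$). Every $q\in\mathbb{H}_{\mathbb R}$ is written $q=a+v$ with scalar part $a=\mathrm{Sc}(q)\in\mathbb{R}$ and vector part $v=v_1e_1+v_2e_2+v_3e_3$, $|v|^2=v_1^2+v_2^2+v_3^2$. For $z\in\mathbb{C}$ the quaternionic power is $$z^q:=z^a\Big[\cos(|v|\log z)+\frac{v}{|v|}\sin(|v|\log z)\Big]\in\mathbb{H}_{\mathbb C},$$ with the principal branch of the logarithm ($-\pi<\arg z\le\pi$), the second term being $0$ if $v=0$, and $0^q:=0$ when $\mathrm{Sc}(q)>0$. The quaternionic Pochhammer symbol and binomial coefficient are $(q)_j:=q(q-1)\cdots(q-j+1)$ (with $(q)_0=1$) and $\binom{q}{j}:=\frac{(q)_j}{j!}$. *)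

(* Defs.v *)
From Stdlib Require Import Reals Lra Factorial.
From Coquelicot Require Import Coquelicot.

Set Implicit Arguments.
Open Scope R_scope.

(** (a, b, c, d) stands for a + b e1 + c e2 + d e3.  The coefficients commute
    with e1, e2, e3, so over [C_Ring] this is the complexification of the
    algebra over [R_Ring].  As an iterated product, [quat K] carries
    Coquelicot's componentwise [plus], [opp], [minus], [zero]. *)
Definition quat (K : Ring) : Type := (K * K * K * K)%type.

Definition HR : Type := quat R_Ring.
Definition HC : Type := quat C_Ring.

Definition qmult {K : Ring} (p q : quat K) : quat K :=
  let '(a1, b1, c1, d1) := p in
  let '(a2, b2, c2, d2) := q in
  (minus (minus (minus (mult a1 a2) (mult b1 b2)) (mult c1 c2)) (mult d1 d2),
   minus (plus (plus (mult a1 b2) (mult b1 a2)) (mult c1 d2)) (mult d1 c2),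
   plus (plus (minus (mult a1 c2) (mult b1 d2)) (mult c1 a2)) (mult d1 b2),
   plus (minus (plus (mult a1 d2) (mult b1 c2)) (mult c1 b2)) (mult d1 a2)).

Definition qscalar {K : Ring} (x : K) : quat K := (x, zero, zero, zero).

Definition e1 {K : Ring} : quat K := (zero, one, zero, zero).
Definition e2 {K : Ring} : quat K := (zero, zero, one, zero).
Definition e3 {K : Ring} : quat K := (zero, zero, zero, one).

Lemma qmult_basis (K : Ring) :
  (qmult e1 e1 = opp (qscalar one) :> quat K) /\
  (qmult e2 e2 = opp (qscalar one) :> quat K) /\
  (qmult e3 e3 = opp (qscalar one) :> quat K) /\
  (qmult e1 e2 = e3 :> quat K) /\ (qmult e2 e1 = opp e3 :> quat K) /\
  (qmult e2 e3 = e1 :> quat K) /\ (qmult e3 e2 = opp e1 :> quat K) /\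
  (qmult e3 e1 = e2 :> quat K) /\ (qmult e1 e3 = opp e2 :> quat K).
Proof.
  assert (hopp : forall a b c d : K,
            opp ((a, b, c, d) : quat K) = (opp a, opp b, opp c, opp d))
    by reflexivity.
  assert (h0 : opp (zero : K) = zero) by exact (@opp_zero K).
  assert (hl : forall x : K, plus zero x = x) by exact (@plus_zero_l K).
  assert (hr : forall x : K, plus x zero = x) by exact (@plus_zero_r K).
  unfold e1, e2, e3, qscalar; repeat split; rewrite ?hopp;
    unfold qmult, minus;
    rewrite ?mult_zero_l, ?mult_zero_r, ?mult_one_l, ?h0, ?hl, ?hr;
    reflexivity.
Qed.

Definition HRtoHC (q : HR) : HC :=
  let '(a, b, c, d) := q in (RtoC a, RtoC b, RtoC c, RtoC d).

Definition Sc (q : HR) : R := let '(a, _, _, _) := q in a.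
Definition Vec (q : HR) : HR := let '(_, b, c, d) := q in (0, b, c, d).
Definition absVec (q : HR) : R :=
  let '(_, b, c, d) := q in sqrt (b ^ 2 + c ^ 2 + d ^ 2).

Definition Cexp (w : C) : C := (exp (Re w) * cos (Im w), exp (Re w) * sin (Im w)).
Definition Ccos (w : C) : C := ((Cexp (Ci * w) + Cexp (- (Ci * w))) / 2)%C.
Definition Csin (w : C) : C := ((Cexp (Ci * w) - Cexp (- (Ci * w))) / (2 * Ci))%C.

Definition Carg (z : C) : R :=
  if Rle_dec 0 (Im z) then acos (Re z / Cmod z) else - acos (Re z / Cmod z).

(** Principal branch; a junk value at [z = 0]. *)
Definition Clog (z : C) : C := (ln (Cmod z), Carg z).

Lemma Clog_principal (z : C) :
  z <> RtoC 0 -> Cexp (Clog z) = z /\ - PI < Im (Clog z) <= PI.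
Proof.
  intros hz.
  assert (hm : 0 < Cmod z) by now apply Cmod_gt_0.
  pose proof (Cmod2_alt z) as hsq.
  pose proof (re_le_Cmod z) as hre.
  pose proof PI_RGT_0 as hpi.
  set (t := Re z / Cmod z).
  assert (hx : Re z = Cmod z * t) by (unfold t; field; lra).
  assert (ht : -1 <= t <= 1).
  { apply Rabs_le_between. unfold t, Rdiv.
    rewrite Rabs_mult, (Rabs_right (/ Cmod z))
      by (apply Rle_ge, Rlt_le, Rinv_0_lt_compat, hm).
    apply (Rmult_le_reg_r (Cmod z)); [exact hm |].
    rewrite Rmult_assoc, Rinv_l by lra. lra. }
  assert (hs : Cmod z * sqrt (1 - Rsqr t) = Rabs (Im z)).
  { rewrite <- (sqrt_pow2 (Cmod z)) at 1 by lra.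
    rewrite <- sqrt_mult by (unfold Rsqr; nra).
    rewrite <- sqrt_Rsqr_abs. f_equal.
    rewrite hx in hsq. unfold Rsqr. nra. }
  pose proof (acos_bound t) as hb.
  unfold Cexp, Clog, Carg; fold t; simpl.
  rewrite exp_ln by exact hm.
  destruct z as [x y]; simpl in *.
  destruct (Rle_dec 0 y) as [hy | hy].
  - rewrite cos_acos, sin_acos, hs, Rabs_right by lra.
    split; [now rewrite <- hx | lra].
  - rewrite cos_neg, sin_neg, cos_acos, sin_acos by lra.
    rewrite <- Ropp_mult_distr_r, hs, Rabs_left, Ropp_involutive by lra.
    split; [now rewrite <- hx | split; [| lra]].
    enough (acos t <> PI) by lra.
    intros E. rewrite <- (sin_acos t), E, sin_PI, Rmult_0_r in hs by lra.
    symmetry in hs. apply Rabs_eq_0 in hs. lra.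
Qed.

(** [z ^ q].  For [z = 0] only the case [0 < Sc q] is meaningful. *)
Definition Cqpow (z : C) (q : HR) : HC :=
  if Ceq_dec z 0 then zero
  else
    qmult (qscalar (Cexp (Sc q * Clog z)%C))
      (plus (qscalar (Ccos (absVec q * Clog z)%C))
         (if Req_EM_T (absVec q) 0 then zero
          else qmult (HRtoHC (qmult (Vec q) (qscalar (/ absVec q))))
                 (qscalar (Csin (absVec q * Clog z)%C)))).

Fixpoint qpoch (q : HR) (j : nat) : HR :=
  match j with
  | O => qscalar one
  | S j' => qmult (qpoch q j') (minus q (qscalar (INR j')))
  end.

Definition qbinom (q : HR) (j : nat) : HR :=
  qmult (qpoch q j) (qscalar (/ INR (fact j))).

(** The Euclidean norm on C^4; [HC] is its carrier. *)
Definition HC_NormedModule : NormedModule C_AbsRing :=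
  prod_NormedModule C_AbsRing
    (prod_NormedModule C_AbsRing
       (prod_NormedModule C_AbsRing C_NormedModule C_NormedModule)
       C_NormedModule)
    C_NormedModule.

(* Main.v *)
Require Import Defs.
From Stdlib Require Import Reals.
From Coquelicot Require Import Coquelicot.
From Stdlib Require Import Factorial Lra Lia.
Open Scope R_scope.

(** Since [(v/|v|)^2 = -1], the subalgebra generated by [q] over the complex
    numbers splits by [v/|v| -> i] and [v/|v| -> -i], so the identity reduces to
    the complex binomial series with exponents [a + i|v|] and [a - i|v|].  Its
    coefficients are absolutely summable by Raabe's criterion, because the
    exponent [alpha] has positive real part.  Along the ray [t -> 1 + t z] the
    sum solves [(1 + t z) F' = alpha z F], hence equals
    [exp (alpha log (1 + t z))] for [t < 1]; Abel's theorem gives [t = 1], where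
    for [z = -1] both sides tend to 0. *)

(** * Binomial coefficients with complex exponent and their absolute summability *)

Fixpoint Cpoch (alpha : C) (j : nat) : C :=
  match j with
  | O => 1
  | S j' => (Cpoch alpha j' * (alpha - INR j'))%C
  end.

Definition Cbinom (alpha : C) (j : nat) : C := (Cpoch alpha j / INR (fact j))%C.

Lemma RtoC_neq_0 (x : R) : x <> 0 -> RtoC x <> 0.
Proof. intros hx E; apply hx; now injection E. Qed.

Lemma im_le_Cmod (c : C) : Rabs (Im c) <= Cmod c.
Proof. eapply Rle_trans; [apply Rmax_r | apply Rmax_Cmod]. Qed.

Lemma Ci_neq_0 : Ci <> 0.
Proof. intros E; injection E; lra. Qed.

(** The ratio of consecutive coefficients, cleared of division. It drives both Raabe's criterion and
    the differential equation. *)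
Lemma Cbinom_S (alpha : C) (j : nat) :
  (INR (S j) * Cbinom alpha (S j) = (alpha - INR j) * Cbinom alpha j)%C.
Proof.
  unfold Cbinom; cbn [Cpoch].
  rewrite fact_simpl, mult_INR, RtoC_mult.
  field; split; apply RtoC_neq_0; [apply INR_fact_neq_0 | apply not_0_INR; lia].
Qed.

(* Raabe's criterion: j |c_j| - (j+1) |c_(j+1)| >= (a/2) |c_j| for large j, and
   the left-hand side telescopes. *)
Lemma ex_series_Cmod_Cbinom (alpha : C) :
  0 < Re alpha -> ex_series (fun j => Cmod (Cbinom alpha j)).
Proof.
  intros ha. destruct alpha as [a m]; simpl in ha.
  set (c := fun j => Cmod (Cbinom (a, m) j)).
  assert (hc : forall j, 0 <= c j) by (intros j; apply Cmod_ge_0).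
  assert (hrec : forall j, INR (S j) * c (S j) = Cmod ((a, m) - INR j) * c j).
  { intros j. unfold c. rewrite <- Cmod_mult, <- Cbinom_S, Cmod_mult, Cmod_R.
    rewrite Rabs_right; [reflexivity | apply Rle_ge, pos_INR]. }
  (* The threshold comes from [(j - a)^2 + m^2 <= (j - a/2)^2], which is equivalent to
     [3/4 a^2 + m^2 <= a j]. The floor rounds down, so its successor is taken. *)
  destruct (nfloor_ex ((3 / 4 * a ^ 2 + m ^ 2) / a)) as [N0 [_ hN0]].
  { apply Rdiv_le_0_compat; nra. }
  set (N := S N0).
  assert (hN : 3 / 4 * a ^ 2 + m ^ 2 <= a * INR N).
  { unfold N; rewrite S_INR.
    apply (Rmult_lt_compat_r a) in hN0; [| exact ha].
    unfold Rdiv in hN0; rewrite Rmult_assoc, Rinv_l in hN0; lra. }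
  clearbody N.
  assert (hstep : forall j, (N <= j)%nat ->
            a / 2 * c j <= INR j * c j - INR (S j) * c (S j)).
  { intros j hj. apply le_INR in hj.
    assert (hj1 : 3 / 4 * a ^ 2 + m ^ 2 <= a * INR j) by nra.
    assert (hj2 : a / 2 <= INR j) by nra.
    assert (hm : Cmod ((a, m) - INR j) <= INR j - a / 2).
    { unfold Cmod; simpl. rewrite <- (sqrt_pow2 (INR j - a / 2)) by lra.
      apply sqrt_le_1_alt. simpl. nra. }
    rewrite hrec. pose proof (hc j). nra. }
  apply (ex_series_incr_n _ N).
  assert (hsum : forall n, a / 2 * sum_n (fun k => c (N + k)%nat) n
            <= INR N * c N - INR (N + S n) * c (N + S n)%nat).
  { induction n as [| n IH].
    - rewrite sum_O, Nat.add_0_r, Nat.add_1_r. apply hstep; lia.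
    - rewrite sum_Sn. unfold plus; simpl. rewrite Rmult_plus_distr_l.
      specialize (hstep (N + S n)%nat ltac:(lia)).
      rewrite (Nat.add_succ_r N (S n)). lra. }
  destruct (ex_finite_lim_seq_incr (sum_n (fun k => c (N + k)%nat))
              (2 / a * (INR N * c N))) as [l hl].
  - intros n. rewrite sum_Sn. unfold plus; simpl. pose proof (hc (N + S n)%nat). lra.
  - intros n. specialize (hsum n).
    assert (0 <= INR (N + S n) * c (N + S n)%nat)
      by (apply Rmult_le_pos; [apply pos_INR | apply hc]).
    apply (Rmult_le_reg_l (a / 2)); [lra |].
    replace (a / 2 * (2 / a * (INR N * c N))) with (INR N * c N) by (field; lra).
    lra.
  - exists l. exact hl.
Qed.

(** * Real power series at the point 1 *)

Lemma CV_radius_ge_1 (u : nat -> R) :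
  ex_series u -> Rbar_le 1 (CV_radius u).
Proof.
  intros hu. destruct (filterlim_bounded u) as [M hM].
  - exists 0. now apply ex_series_lim_0.
  - apply (proj1 (CV_radius_bounded u)). exists M. intros n.
    rewrite pow1, Rmult_1_r. exact (hM n).
Qed.

(** If the radius exceeds 1, the sum is continuous at 1; if it equals 1, this is Abel's theorem.
    Both cases occur: for a natural exponent the binomial series is a polynomial. *)
Lemma Abel_1 (u : nat -> R) :
  ex_series u -> filterlim (PSeries u) (at_left 1) (locally (Series u)).
Proof.
  intros hu. rewrite <- (PSeries_1 u).
  destruct (Rbar_le_lt_or_eq_dec _ _ (CV_radius_ge_1 u hu)) as [hr | hr].
  - intros P hP. apply filter_le_within.
    apply (continuity_pt_filterlim (PSeries u) 1); [| exact hP].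
    apply PSeries_continuity. now rewrite Rabs_R1.
  - pose proof (Abel u) as hA. rewrite <- hr in hA.
    apply hA; simpl; [lra | exact I |].
    apply ex_series_ext with (2 := hu). intros n.
    rewrite pow_n_pow, pow1. unfold scal; simpl; unfold mult; simpl. ring.
Qed.

(** * The principal logarithm on the right half-plane *)

(** Trades the [acos] with its case distinction for one smooth formula, which can be differentiated
    even across the real axis. *)
Lemma Clog_Re_pos (w : C) : 0 < Re w ->
  Clog w = (ln (Re w ^ 2 + Im w ^ 2) / 2, atan (Im w / Re w)).
Proof.
  destruct w as [x y]; simpl; intros hx.
  assert (hs : 0 < x ^ 2 + y ^ 2) by nra.
  assert (hC : 0 < Cmod (x, y)) by now apply sqrt_lt_R0.
  unfold Clog. f_equal.
  - assert (hln : ln (Cmod (x, y) ^ 2) = ln (x ^ 2 + y ^ 2)).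
    { f_equal. apply Cmod2_alt. }
    simpl in hln. rewrite Rmult_1_r, ln_mult in hln by exact hC. simpl. lra.
  - assert (hcos : x / Cmod (x, y) = cos (atan (y / x))).
    { rewrite cos_atan. unfold Cmod; simpl.
      replace (x * (x * 1) + y * (y * 1)) with (x ^ 2 * (1 + Rsqr (y / x)))
        by (unfold Rsqr; field; lra).
      rewrite sqrt_mult_alt, sqrt_pow2 by nra.
      field. split; [| lra].
      apply Rgt_not_eq, sqrt_lt_R0. pose proof (Rle_0_sqr (y / x)). lra. }
    pose proof (atan_bound (y / x)) as hb.
    unfold Carg; simpl. rewrite hcos.
    (* The sign of [y] decides which of [atan (y / x)] and its opposite lies in [[0, PI]], where
       [acos] inverts [cos]. *)
    destruct (Rle_dec 0 y) as [hy | hy].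
    + apply acos_cos. split; [| lra].
      rewrite <- atan_0.
      pose proof (Rdiv_le_0_compat y x hy hx).
      destruct (Rle_lt_or_eq_dec 0 (y / x)) as [h1 | h1]; [assumption | |].
      * apply atan_increasing in h1. lra.
      * rewrite <- h1. lra.
    + rewrite <- cos_neg. rewrite acos_cos; [ring |].
      assert (y / x < 0) as h1 by (apply Rdiv_neg_pos; lra).
      apply atan_increasing in h1. rewrite atan_0 in h1. lra.
Qed.

(** * The binomial series along the ray [1 + t z] *)

Definition Cbinom_term (alpha z : C) (j : nat) : C := (Cbinom alpha j * z ^ j)%C.

(** This is [(1 + t z) F' = alpha z F] read off at the coefficient of [t^j]. *)
Lemma Cbinom_term_S (alpha z : C) (j : nat) :
  (INR (S j) * Cbinom_term alpha z (S j) + INR j * z * Cbinom_term alpha z j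
   = alpha * z * Cbinom_term alpha z j)%C.
Proof.
  unfold Cbinom_term. rewrite Cpow_S.
  transitivity ((INR (S j) * Cbinom alpha (S j)) * (z * z ^ j)
                + INR j * z * (Cbinom alpha j * z ^ j))%C; [ring |].
  rewrite Cbinom_S. ring.
Qed.

(** Since [|z^j| <= 1], the absolute values of the binomial coefficients dominate both parts. *)
Lemma ex_series_Cbinom_term (alpha z : C) :
  0 < Re alpha -> Cmod z <= 1 ->
  ex_series (fun j => Re (Cbinom_term alpha z j)) /\
  ex_series (fun j => Im (Cbinom_term alpha z j)).
Proof.
  intros ha hz.
  assert (hb : forall j, Cmod (Cbinom_term alpha z j) <= Cmod (Cbinom alpha j)).
  { intros j. unfold Cbinom_term. rewrite Cmod_mult, Cmod_pow.
    rewrite <- (Rmult_1_r (Cmod (Cbinom alpha j))) at 2.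
    apply Rmult_le_compat_l; [apply Cmod_ge_0 |].
    rewrite <- (pow1 j). apply pow_incr. split; [apply Cmod_ge_0 | exact hz]. }
  split; (apply (@ex_series_le R_AbsRing R_CompleteNormedModule)
    with (2 := ex_series_Cmod_Cbinom alpha ha));
  intros j; (eapply Rle_trans; [| apply hb]).
  - apply re_le_Cmod.
  - apply im_le_Cmod.
Qed.

Lemma is_pseries_PS_derive (u : nat -> R) (t : R) :
  Rbar_lt (Rabs t) (CV_radius u) ->
  is_pseries (PS_derive u) t (PSeries (PS_derive u) t) /\
  is_pseries (PS_incr_1 (PS_derive u)) t (t * PSeries (PS_derive u) t).
Proof.
  intros ht.
  assert (h : is_pseries (PS_derive u) t (PSeries (PS_derive u) t)).
  { apply PSeries_correct, CV_radius_inside. now rewrite CV_radius_derive. }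
  split; [exact h | exact (is_pseries_incr_1 _ _ _ h)].
Qed.

(* [w] is the coefficient sequence of a solution of [(1 + t z) F' = b F]. *)
Lemma PSeries_binomial_ode (w : nat -> C) (b z : C) (t : R)
  (u := fun j => Re (w j)) (v := fun j => Im (w j)) :
  (forall j, INR (S j) * w (S j) + INR j * z * w j = b * w j)%C ->
  Rbar_lt (Rabs t) (CV_radius u) -> Rbar_lt (Rabs t) (CV_radius v) ->
  ((1 + t * z) * (PSeries (PS_derive u) t, PSeries (PS_derive v) t)
   = b * (PSeries u t, PSeries v t))%C.
Proof.
  intros hw hu hv.
  destruct (is_pseries_PS_derive u t hu) as [hu1 hu2].
  destruct (is_pseries_PS_derive v t hv) as [hv1 hv2].
  pose proof (PSeries_correct u t (CV_radius_inside u t hu)) as hu0.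
  pose proof (PSeries_correct v t (CV_radius_inside v t hv)) as hv0.
  assert (hcomm : forall c : R, mult t c = mult c t) by (intros c; apply Rmult_comm).
  (* The coefficients of [t f'(t)]; at [j = 0] the shift inserts 0, which matches the factor
     [INR 0]. *)
  assert (hshift : forall (f : nat -> R) j, PS_incr_1 (PS_derive f) j = INR j * f j).
  { intros f [| j]; [unfold PS_incr_1; simpl; unfold zero; simpl; ring | reflexivity]. }
  pose proof (is_pseries_plus _ _ _ _ _ hu1
    (is_pseries_plus _ _ _ _ _ (is_pseries_scal (Re z) _ _ _ (hcomm _) hu2)
       (is_pseries_scal (- Im z) _ _ _ (hcomm _) hv2))) as hL1.
  (* With [F = u + i v], [hL1] and [hL2] expand the real and imaginary parts of [F' + z t F'], while
     [hR1] and [hR2] expand those of [b F]. Equal coefficients then force equal sums. *)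
  pose proof (is_pseries_plus _ _ _ _ _ hv1
    (is_pseries_plus _ _ _ _ _ (is_pseries_scal (Re z) _ _ _ (hcomm _) hv2)
       (is_pseries_scal (Im z) _ _ _ (hcomm _) hu2))) as hL2.
  pose proof (is_pseries_plus _ _ _ _ _ (is_pseries_scal (Re b) _ _ _ (hcomm _) hu0)
       (is_pseries_scal (- Im b) _ _ _ (hcomm _) hv0)) as hR1.
  pose proof (is_pseries_plus _ _ _ _ _ (is_pseries_scal (Re b) _ _ _ (hcomm _) hv0)
       (is_pseries_scal (Im b) _ _ _ (hcomm _) hu0)) as hR2.
  assert (hcoef : forall j,
    INR (S j) * u (S j) + (Re z * (INR j * u j) + - Im z * (INR j * v j))
      = Re b * u j + - Im b * v j /\
    INR (S j) * v (S j) + (Re z * (INR j * v j) + Im z * (INR j * u j))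
      = Re b * v j + Im b * u j).
  { intros j. specialize (hw j). unfold u, v.
    generalize dependent (INR (S j)). intros n hw.
    split; [apply (f_equal Re) in hw | apply (f_equal Im) in hw];
      simpl in hw |- *; unfold Re, Im in *; lra. }
  apply (is_pseries_ext _ (PS_plus (PS_scal (Re b) u) (PS_scal (- Im b) v))) in hL1.
  2:{ intros j. unfold PS_plus, PS_scal. rewrite !hshift. apply hcoef. }
  apply (is_pseries_ext _ (PS_plus (PS_scal (Re b) v) (PS_scal (Im b) u))) in hL2.
  2:{ intros j. unfold PS_plus, PS_scal. rewrite !hshift. apply hcoef. }
  apply is_pseries_unique in hL1, hL2, hR1, hR2.
  rewrite hR1 in hL1. rewrite hR2 in hL2. clear hR1 hR2.
  revert hL1 hL2. unfold plus, scal; simpl; unfold mult; simpl.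
  generalize (PSeries (PS_derive u) t) (PSeries (PS_derive v) t)
    (PSeries u t) (PSeries v t). intros. unfold Re, Im in *.
  destruct b, z; simpl in *.
  unfold Cmult, Cplus; simpl. f_equal; lra.
Qed.

(** Positivity of the real part is an open condition, so the smooth formula for [Clog] holds near
    [t] and can be differentiated there. *)
Lemma is_derive_Clog_ray (z : C) (t : R) (w := (1 + t * z)%C) : 0 < Re w ->
  is_derive (fun s : R => Re (Clog (1 + s * z))) t (Re (z / w)) /\
  is_derive (fun s : R => Im (Clog (1 + s * z))) t (Im (z / w)).
Proof.
  destruct z as [x y]. intros hw.
  assert (hw' : 0 < 1 + t * x) by (simpl in hw; lra).
  assert (hloc : locally t (fun s : R => 0 < 1 + s * x)).
  { apply (open_comp (fun s : R => 1 + s * x) (fun u => 0 < u));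
      [| apply open_gt | exact hw'].
    intros s _. apply (ex_derive_continuous (fun s : R => 1 + s * x)).
    auto_derive. exact I. }
  assert (hlog : locally t (fun s : R => Clog (1 + s * (x, y))
            = (ln ((1 + s * x) ^ 2 + (s * y) ^ 2) / 2, atan (s * y / (1 + s * x))))).
  { revert hloc. apply filter_imp. intros s hs.
    rewrite Clog_Re_pos by (simpl; lra).
    replace (1 + s * (x, y))%C with (1 + s * x, s * y); [reflexivity |].
    unfold Cplus, Cmult; simpl. f_equal; ring. }
  assert (hpos : 0 < (1 + t * x) ^ 2 + (t * y) ^ 2) by nra.
  assert (hdiv : ((x, y) / w)%C
            = ((x * (1 + t * x) + y * (t * y)) / ((1 + t * x) ^ 2 + (t * y) ^ 2),
               y / ((1 + t * x) ^ 2 + (t * y) ^ 2))).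
  { unfold w, Cdiv, Cinv, Cmult, Cplus; simpl.
    f_equal; field; simpl in hpos; lra. }
  rewrite hdiv; simpl.
  split.
  - apply (is_derive_ext_loc (fun s : R => ln ((1 + s * x) ^ 2 + (s * y) ^ 2) / 2)).
    { refine (filter_imp _ _ _ hlog). intros s hs. exact (f_equal Re (eq_sym hs)). }
    auto_derive; [| field]; simpl in hpos; lra.
  - apply (is_derive_ext_loc (fun s : R => atan (s * y / (1 + s * x)))).
    { refine (filter_imp _ _ _ hlog). intros s hs. exact (f_equal Im (eq_sym hs)). }
    auto_derive; [lra |].
    unfold Rsqr. field. simpl in hpos. repeat split; nra.
Qed.

(* [F' = alpha z / (1 + t z) F], so [exp (- alpha log (1 + t z)) F] is constant. *)
Lemma PSeries_Cbinom_ray (alpha z : C) (t : R) :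
  0 < Re alpha -> Cmod z <= 1 -> 0 <= t < 1 ->
  (PSeries (fun j => Re (Cbinom_term alpha z j)) t,
   PSeries (fun j => Im (Cbinom_term alpha z j)) t)
  = Cexp (alpha * Clog (1 + t * z)).
Proof.
  intros ha hz ht.
  set (u := fun j => Re (Cbinom_term alpha z j)).
  set (v := fun j => Im (Cbinom_term alpha z j)).
  destruct (ex_series_Cbinom_term alpha z ha hz) as [hu hv].
  apply CV_radius_ge_1 in hu, hv. fold u in hu. fold v in hv.
  set (p := fun s : R => Re (alpha * Clog (1 + s * z))).
  set (r := fun s : R => Im (alpha * Clog (1 + s * z))).
  pose proof (re_le_Cmod z) as hre. apply Rabs_le_between in hre.
  (* The two functions are the real and imaginary parts of [exp (- (p + i r)) (u + i v)]. *)
  assert (hd : forall s, 0 <= s <= t ->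
    is_derive (fun s => exp (- p s) * (cos (r s) * PSeries u s + sin (r s) * PSeries v s))
      s 0 /\
    is_derive (fun s => exp (- p s) * (cos (r s) * PSeries v s - sin (r s) * PSeries u s))
      s 0).
  { intros s hs.
    assert (hw : 0 < Re (1 + s * z)).
    { destruct z as [x y]; simpl in *. nra. }
    assert (hs1 : Rbar_lt (Rabs s) 1) by (simpl; rewrite Rabs_right; lra).
    pose proof (Rbar_lt_le_trans _ _ _ hs1 hu) as hsu.
    pose proof (Rbar_lt_le_trans _ _ _ hs1 hv) as hsv.
    pose proof (is_derive_PSeries u s hsu) as hdu.
    pose proof (is_derive_PSeries v s hsv) as hdv.
    pose proof (PSeries_binomial_ode (Cbinom_term alpha z) (alpha * z) z s
      (Cbinom_term_S alpha z) hsu hsv) as hode.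
    fold u v in hode.
    destruct (is_derive_Clog_ray z s hw) as [hl1 hl2].
    set (w := (1 + s * z)%C) in *.
    assert (hw0 : w <> 0) by (intros E0; rewrite E0 in hw; simpl in hw; lra).
    (* [k] is at once the derivative of [p + i r] and the logarithmic derivative of [F], so the two
       contributions to the derivative of the product cancel. *)
    set (k := (alpha * (z / w))%C).
    assert (hode' : (PSeries (PS_derive u) s, PSeries (PS_derive v) s)
              = (k * (PSeries u s, PSeries v s))%C).
    { assert (hdivw : forall F G : C, (w * F = alpha * z * G)%C -> F = (k * G)%C).
      { intros F G hFG. transitivity ((w * F) / w)%C; [now field |].
        rewrite hFG. unfold k. now field. }
      now apply hdivw. }
    assert (hp : is_derive p s (Re k)).
    { apply (is_derive_ext (fun s : R => Re alpha * Re (Clog (1 + s * z))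
                - Im alpha * Im (Clog (1 + s * z)))); [reflexivity |].
      apply (is_derive_minus (V := R_NormedModule)); apply is_derive_scal; assumption. }
    assert (hr : is_derive r s (Im k)).
    { apply (is_derive_ext (fun s : R => Re alpha * Im (Clog (1 + s * z))
                + Im alpha * Re (Clog (1 + s * z)))); [reflexivity |].
      apply (is_derive_plus (V := R_NormedModule)); apply is_derive_scal; assumption. }
    clearbody k. destruct k as [k1 k2]. unfold Cmult in hode'. simpl in hode'.
    injection hode' as e1 e2. rewrite e1 in hdu. rewrite e2 in hdv.
    simpl in hp, hr. clear - hp hr hdu hdv.
    generalize dependent (PSeries v). intros V hV hU.
    generalize dependent (PSeries u). intros U hU hV.
    split; auto_derive.
    all: repeat split; try (eexists; eassumption).
    all: change (Derive (fun x : R => p x) s) with (Derive p s).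
    all: change (Derive (fun x : R => r x) s) with (Derive r s).
    all: change (Derive (fun x : R => U x) s) with (Derive U s).
    all: change (Derive (fun x : R => V x) s) with (Derive V s).
    all: rewrite (is_derive_unique _ _ _ hp), (is_derive_unique _ _ _ hr),
      (is_derive_unique _ _ _ hU), (is_derive_unique _ _ _ hV); ring. }
  assert (hlog0 : Clog (1 + 0 * z) = 0).
  { replace (1 + 0 * z)%C with (RtoC 1) by ring.
    rewrite Clog_Re_pos by (simpl; lra). simpl.
    replace (1 * (1 * 1) + 0 * (0 * 1)) with 1 by ring.
    replace (0 / 1) with 0 by field.
    rewrite ln_1, atan_0. unfold RtoC. f_equal. field. }
  assert (hp0 : p 0 = 0) by (unfold p; rewrite hlog0; simpl; ring).
  assert (hr0 : r 0 = 0) by (unfold r; rewrite hlog0; simpl; ring).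
  assert (hw0 : Cbinom_term alpha z 0 = 1).
  { unfold Cbinom_term, Cbinom; simpl. field. }
  assert (h1 : exp (- p t) * (cos (r t) * PSeries u t + sin (r t) * PSeries v t) = 1 /\
               exp (- p t) * (cos (r t) * PSeries v t - sin (r t) * PSeries u t) = 0).
  { destruct (Rle_lt_or_eq_dec 0 t (proj1 ht)) as [ht0 | <-].
    - split.
      + etransitivity; [symmetry; apply (eq_is_derive _ 0 t (fun s hs => proj1 (hd s hs)) ht0) |].
        rewrite hp0, hr0, !PSeries_0. unfold u, v. rewrite hw0.
        simpl. rewrite Ropp_0, exp_0, cos_0, sin_0. ring.
      + etransitivity; [symmetry; apply (eq_is_derive _ 0 t (fun s hs => proj2 (hd s hs)) ht0) |].
        rewrite hp0, hr0, !PSeries_0. unfold u, v. rewrite hw0.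
        simpl. rewrite Ropp_0, exp_0, cos_0, sin_0. ring.
    - rewrite hp0, hr0, !PSeries_0. unfold u, v. rewrite hw0.
      simpl. rewrite Ropp_0, exp_0, cos_0, sin_0. split; ring. }
  destruct h1 as [h1 h2].
  assert (hexp : exp (p t) * exp (- p t) = 1) by (rewrite <- exp_plus, Rplus_opp_r; apply exp_0).
  pose proof (sin2_cos2 (r t)) as hsc. unfold Rsqr in hsc.
  (* Multiplying by [f (c + i s)], the inverse of [e (c - i s)], recovers [U + i V]. *)
  assert (halg : forall e f c s U V : R, f * e = 1 -> s * s + c * c = 1 ->
    e * (c * U + s * V) = 1 -> e * (c * V - s * U) = 0 -> (U, V) = (f * c, f * s)).
  { intros e f c s U V he hcs hU hV. f_equal.
    - transitivity (f * (c * (e * (c * U + s * V)) - s * (e * (c * V - s * U)))).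
      + transitivity ((f * e) * (s * s + c * c) * U); [rewrite he, hcs |]; ring.
      + rewrite hU, hV. ring.
    - transitivity (f * (s * (e * (c * U + s * V)) + c * (e * (c * V - s * U)))).
      + transitivity ((f * e) * (s * s + c * c) * V); [rewrite he, hcs |]; ring.
      + rewrite hU, hV. ring. }
  exact (halg _ _ _ _ _ _ hexp hsc h1 h2).
Qed.

(** * Limits of pairs, and the end [t = 1] of the ray *)

Lemma filterlim_pair_prod {T : Type} {U V : UniformSpace} (F : (T -> Prop) -> Prop)
  {FF : Filter F} (f : T -> U) (g : T -> V) (a : U) (b : V) :
  filterlim f F (locally a) -> filterlim g F (locally b) ->
  filterlim (fun t => (f t, g t)) F (locally ((a, b) : prod_UniformSpace U V)).
Proof.
  intros hf hg. apply filterlim_locally. intros eps.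
  apply filterlim_locally with (eps := eps) in hf.
  apply filterlim_locally with (eps := eps) in hg.
  generalize (filter_and _ _ hf hg). apply filter_imp.
  intros t [h1 h2]. now split.
Qed.

(** The closed unit disc meets the half-plane [Re z <= -1] only at [z = -1]. *)
Lemma Re_1_plus_pos (z : C) : Cmod z <= 1 -> (1 + z)%C <> 0 -> 0 < Re (1 + z).
Proof.
  intros hz h0. pose proof (Cmod2_alt z) as h2. pose proof (Cmod_ge_0 z) as h3.
  destruct z as [x y]; simpl in *.
  destruct (Rlt_dec 0 (1 + x)) as [h | h]; [exact h | exfalso].
  assert (hxy : x = -1 /\ y = 0) by (split; nra).
  destruct hxy as [-> ->]. apply h0. unfold Cplus, RtoC; simpl. f_equal; ring.
Qed.

(** On this ray the base is the positive real [1 - t], so the modulus is [(1 - t)^(Re alpha)]; the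
    imaginary part of [alpha] only rotates. *)
Lemma Cexp_Clog_ray_vanishes (alpha : C) (eps : posreal) : 0 < Re alpha ->
  at_left 1 (fun t : R => Cmod (Cexp (alpha * Clog (1 + t * -1))) < eps).
Proof.
  intros ha.
  (* The distance to 1 is [eps^(1 / Re alpha)]. *)
  assert (hd : 0 < exp (ln eps / Re alpha)) by apply exp_pos.
  exists (mkposreal _ hd). intros t ht ht1.
  rewrite Clog_Re_pos by (simpl; lra).
  destruct alpha as [a m]; simpl in *.
  assert (Cmod_Cexp : forall w, Cmod (Cexp w) = exp (Re w)).
  { intros [p r]. unfold Cmod, Cexp; simpl.
    transitivity (sqrt (exp p ^ 2)); [f_equal | apply sqrt_pow2, Rlt_le, exp_pos].
    pose proof (sin2_cos2 r) as h. unfold Rsqr in h.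
    transitivity ((exp p) ^ 2 * (sin r * sin r + cos r * cos r)); [ring |].
    rewrite h; ring. }
  rewrite Cmod_Cexp; simpl.
  replace ((0 + (t * 0 + 0 * -1)) / (1 + (t * -1 - 0 * 0))) with 0 by (field; lra).
  rewrite atan_0.
  replace ((1 + (t * -1 - 0 * 0)) * ((1 + (t * -1 - 0 * 0)) * 1)
    + (0 + (t * 0 + 0 * -1)) * ((0 + (t * 0 + 0 * -1)) * 1))
    with ((1 - t) * (1 - t)) by ring.
  rewrite ln_mult by lra.
  rewrite <- (exp_ln eps) by apply cond_pos. apply exp_increasing.
  assert (hln : ln (1 - t) < ln eps / a).
  { rewrite <- (ln_exp (ln eps / a)). apply ln_increasing; [lra |].
    unfold ball in ht; simpl in ht; unfold AbsRing_ball, abs, minus, plus, opp in ht;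
      simpl in ht. rewrite Rabs_left in ht; lra. }
  apply (Rmult_lt_compat_l a) in hln; [| exact ha].
  replace (a * (ln eps / a)) with (ln eps) in hln by (field; lra). lra.
Qed.

(** For [z = -1] the modulus tends to 0. Otherwise [1 + z] lies in the right half-plane, where the
    logarithm along the ray is differentiable, hence continuous, up to [t = 1]. *)
Lemma filterlim_Cexp_Clog_ray (alpha z : C)
  (l := if Ceq_dec (1 + z) 0 then RtoC 0 else Cexp (alpha * Clog (1 + z))) :
  0 < Re alpha -> Cmod z <= 1 ->
  filterlim (fun t : R => Re (Cexp (alpha * Clog (1 + t * z)))) (at_left 1)
    (locally (Re l)) /\
  filterlim (fun t : R => Im (Cexp (alpha * Clog (1 + t * z)))) (at_left 1)
    (locally (Im l)).
Proof.
  intros ha hz. unfold l; clear l. destruct (Ceq_dec (1 + z) 0) as [h0 | h0].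
  - assert (hz1 : z = (-1)%C).
    { transitivity ((1 + z) - 1)%C; [ring |]. rewrite h0. ring. }
    rewrite hz1. split; apply filterlim_locally; intros eps;
      generalize (Cexp_Clog_ray_vanishes alpha eps ha); apply filter_imp;
      intros t; generalize (Cexp (alpha * Clog (1 + t * -1))); intros w ht;
      unfold ball; simpl; unfold AbsRing_ball, abs, minus, plus, opp;
      simpl; rewrite Ropp_0, Rplus_0_r; (eapply Rle_lt_trans; [| exact ht]).
    + exact (re_le_Cmod w).
    + exact (im_le_Cmod w).
  - pose proof (Re_1_plus_pos z hz h0) as hw.
    assert (hone : (1 + 1 * z)%C = (1 + z)%C) by ring.
    destruct (is_derive_Clog_ray z 1) as [h1 h2]; [now rewrite hone |].
    set (lr := fun s : R => Re (Clog (1 + s * z))) in h1.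
    set (li := fun s : R => Im (Clog (1 + s * z))) in h2.
    rewrite <- hone.
    split; (apply filterlim_filter_le_1 with (1 := filter_le_within _)).
    + apply (ex_derive_continuous (fun s : R => exp (Re alpha * lr s - Im alpha * li s)
        * cos (Re alpha * li s + Im alpha * lr s))).
      auto_derive; repeat split; eexists; eassumption.
    + apply (ex_derive_continuous (fun s : R => exp (Re alpha * lr s - Im alpha * li s)
        * sin (Re alpha * li s + Im alpha * lr s))).
      auto_derive; repeat split; eexists; eassumption.
Qed.

(** * Componentwise series and the complex binomial series *)

Lemma sum_n_pair {U V : AbelianMonoid} (f : nat -> U) (g : nat -> V) (n : nat) :
  sum_n (fun j => (f j, g j) : prod_AbelianMonoid U V) n = (sum_n f n, sum_n g n).
Proof.
  induction n as [| n IH]; [now rewrite !sum_O | now rewrite !sum_Sn, IH].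
Qed.

Lemma is_series_pair {K : AbsRing} {U V : NormedModule K} (f : nat -> U) (g : nat -> V)
  (a : U) (b : V) :
  is_series f a -> is_series g b ->
  is_series (V := prod_NormedModule K U V) (fun j => (f j, g j)) (a, b).
Proof.
  intros hf hg. unfold is_series.
  apply (filterlim_ext (fun n => (sum_n f n, sum_n g n))).
  - intros n. symmetry. exact (sum_n_pair f g n).
  - exact (filterlim_pair_prod _ _ _ _ _ hf hg).
Qed.

Lemma is_series_C (w : nat -> C) (a b : R) :
  is_series (fun j => Re (w j)) a -> is_series (fun j => Im (w j)) b ->
  is_series (V := C_NormedModule) w (a, b).
Proof.
  intros ha hb.
  apply (is_series_ext (V := C_NormedModule) (fun j => (Re (w j), Im (w j)))).
  - intros j. now destruct (w j).
  - exact (is_series_pair _ _ _ _ ha hb).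
Qed.

(** Power series and exponential agree for [0 <= t < 1]. Their left limits at 1 are the sum, by
    Abel's theorem, and the claimed value, so these coincide. *)
Lemma is_series_Cbinom (alpha z : C) :
  0 < Re alpha -> Cmod z <= 1 ->
  is_series (V := C_NormedModule) (Cbinom_term alpha z)
    (if Ceq_dec (1 + z) 0 then RtoC 0 else Cexp (alpha * Clog (1 + z))).
Proof.
  intros ha hz.
  destruct (ex_series_Cbinom_term alpha z ha hz) as [hu hv].
  destruct (filterlim_Cexp_Clog_ray alpha z ha hz) as [hl1 hl2].
  set (l := if Ceq_dec (1 + z) 0 then RtoC 0 else Cexp (alpha * Clog (1 + z))) in *.
  assert (hnear : at_left 1 (fun t => 0 <= t < 1)).
  { exists (mkposreal 1 Rlt_0_1). intros t ht ht1.
    unfold ball in ht; simpl in ht; unfold AbsRing_ball, abs, minus, plus, opp in ht;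
      simpl in ht. apply Rabs_def2 in ht. lra. }
  assert (e1 : Series (fun j => Re (Cbinom_term alpha z j)) = Re l).
  { refine (filterlim_locally_unique (V := R_NormedModule) (F := at_left 1) _ _ _ (Abel_1 _ hu) _).
    refine (filterlim_ext_loc _ _ _ hl1). revert hnear. apply filter_imp.
    intros t ht. now rewrite <- (PSeries_Cbinom_ray alpha z t ha hz ht). }
  assert (e2 : Series (fun j => Im (Cbinom_term alpha z j)) = Im l).
  { refine (filterlim_locally_unique (V := R_NormedModule) (F := at_left 1) _ _ _ (Abel_1 _ hv) _).
    refine (filterlim_ext_loc _ _ _ hl2). revert hnear. apply filter_imp.
    intros t ht. now rewrite <- (PSeries_Cbinom_ray alpha z t ha hz ht). }
  apply Series_correct in hu, hv. rewrite e1 in hu. rewrite e2 in hv.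
  replace l with (Re l, Im l) by now destruct l.
  now apply is_series_C.
Qed.

(** * Splitting quaternionic powers and binomials into conjugate complex ones *)

Lemma Cexp_plus (u v : C) : Cexp (u + v) = (Cexp u * Cexp v)%C.
Proof.
  destruct u as [u1 u2], v as [v1 v2]. unfold Cexp, Cplus, Cmult; simpl.
  rewrite exp_plus, cos_plus, sin_plus. f_equal; ring.
Qed.

Lemma quat_eq {K : Type} (a b c d a' b' c' d' : K) :
  a = a' -> b = b' -> c = c' -> d = d' -> (a, b, c, d) = (a', b', c', d').
Proof. now intros -> -> -> ->. Qed.

Lemma absVec_pow2 (a b c d : R) :
  absVec (a, b, c, d) ^ 2 = b ^ 2 + c ^ 2 + d ^ 2.
Proof. simpl absVec. rewrite pow2_sqrt; [reflexivity | nra]. Qed.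

Lemma absVec_eq_0 (a b c d : R) :
  absVec (a, b, c, d) = 0 -> b = 0 /\ c = 0 /\ d = 0.
Proof.
  intros h. pose proof (absVec_pow2 a b c d) as h2. rewrite h in h2. nra.
Qed.

(* [q] generates a copy of the complex numbers in which it acts as [a + i |v|]
   and its conjugate as [a - i |v|]; [y] is the vector part of [(q)_j] divided
   by [v]. *)
Lemma qpoch_Cpoch (a b c d : R) (j : nat) (m := absVec (a, b, c, d)) :
  exists x y : R, qpoch (a, b, c, d) j = (x, b * y, c * y, d * y) /\
    Cpoch (a, m) j = (x, m * y) /\ Cpoch (a, - m) j = (x, - m * y).
Proof.
  assert (hm : m * m = b ^ 2 + c ^ 2 + d ^ 2).
  { rewrite <- (absVec_pow2 a). unfold m. ring. }
  clearbody m.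
  induction j as [| j (x & y & h1 & h2 & h3)].
  - exists 1, 0. repeat split; unfold RtoC; simpl; unfold qscalar, one, zero; simpl;
      now rewrite ?Rmult_0_r.
  (* The witnesses expand [(x + v y) (a - j + v)] using [v^2 = - m^2]. *)
  - exists (x * (a - INR j) - m * m * y), (x + y * (a - INR j)).
    cbn [qpoch Cpoch]. rewrite h1, h2, h3.
    unfold qmult, qscalar, minus, plus, opp, mult, zero, Cmult, Cminus, Cplus, Copp, RtoC.
    simpl. unfold plus, opp; simpl.
    repeat split; [apply (quat_eq (K := R)) | f_equal | f_equal]; try ring.
    rewrite hm. ring.
Qed.

(* When [(b, c, d)] is a unit vector [n], the element of the commutative algebra
   generated by [n] that equals [A] where [n] is read as [i] and [B] where it is
   read as [- i].  For [v = 0] it is applied to [n = 0], since [/ 0] is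
   multiplied by the vanishing components of [v]. *)
Definition from_conj (v : C * C * C) (A B : C) : HC :=
  let '(b, c, d) := v in
  ((A + B) / 2, b * ((A - B) / (2 * Ci)), c * ((A - B) / (2 * Ci)),
   d * ((A - B) / (2 * Ci)))%C.

Lemma qbinom_term (a b c d : R) (z : C) (j : nat) (m := absVec (a, b, c, d)) :
  qmult (HRtoHC (qbinom (a, b, c, d) j)) (qscalar (Cpow z j))
  = from_conj (RtoC (b * / m), RtoC (c * / m), RtoC (d * / m))
      (Cbinom_term (a, m) z j) (Cbinom_term (a, - m) z j).
Proof.
  destruct (qpoch_Cpoch a b c d j) as (x & y & h1 & h2 & h3). fold m in h2, h3.
  assert (hv : forall s, m = 0 -> s = b \/ s = c \/ s = d -> s = 0).
  { intros s h0 hs. destruct (absVec_eq_0 a b c d h0) as (-> & -> & ->). tauto. }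
  (* This survives [m = 0], since the components of [v] then vanish, whatever the value of [/ m]. *)
  assert (hinv : forall s, s = b \/ s = c \/ s = d -> s * / m * m = s).
  { intros s hs. destruct (Req_dec m 0) as [h0 | h0].
    - rewrite (hv s h0 hs). ring.
    - field. exact h0. }
  unfold from_conj, Cbinom_term, Cbinom, qbinom. rewrite h1, h2, h3.
  clearbody m. generalize (Cpow z j). intros w. clear h1 h2 h3.
  set (f := INR (fact j)).
  assert (hf : f <> 0) by apply INR_fact_neq_0. clearbody f.
  pose proof Ci_neq_0 as hCi.
  assert (hp : (x, m * y) = (x + Ci * (m * y))%C :> C)
    by (apply injective_projections; simpl; ring).
  assert (hn : (x, - m * y) = (x - Ci * (m * y))%C :> C)
    by (apply injective_projections; simpl; ring).
  assert (hscal : forall (s : R), s = b \/ s = c \/ s = d ->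
    (RtoC (s * / m)%R * (((x, m * y)%R / f * w - (x, - m * y)%R / f * w) / (2 * Ci))
      = RtoC (s * y * / f)%R * w)%C).
  { intros s hs. rewrite hp, hn.
    rewrite <- (hinv s hs) at 2. rewrite !RtoC_mult, (RtoC_inv f hf).
    (* With the inverse made opaque, the identity is proved without assuming [m <> 0]. *)
    generalize (RtoC (/ m)). intros m'.
    field. split; [now apply RtoC_neq_0 | exact hCi]. }
  rewrite !hscal by tauto.
  unfold qmult, qscalar, HRtoHC, minus, plus, opp, mult, zero; simpl.
  rewrite !Rmult_0_r, !Ropp_0, !Rplus_0_r, !Rplus_0_l.
  apply (quat_eq (K := C)); [| ring ..].
  rewrite hp, hn, RtoC_mult, (RtoC_inv f hf).
  field. now apply RtoC_neq_0.
Qed.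

(** Writing cosine and sine through [exp (i m L)] and [exp (- i m L)], with [L = Clog w], and
    absorbing the factor [exp (a L)] produces the exponents [a + i m] and [a - i m]. *)
Lemma Cqpow_from_conj (a b c d : R) (w : C) (m := absVec (a, b, c, d)) :
  Cqpow w (a, b, c, d)
  = from_conj (RtoC (b * / m), RtoC (c * / m), RtoC (d * / m))
      (if Ceq_dec w 0 then RtoC 0 else Cexp ((a, m) * Clog w))
      (if Ceq_dec w 0 then RtoC 0 else Cexp ((a, - m) * Clog w)).
Proof.
  pose proof Ci_neq_0 as hCi.
  unfold Cqpow, from_conj. destruct (Ceq_dec w 0) as [_ | _].
  - apply (quat_eq (K := C)); unfold zero; simpl; field; exact hCi.
  - fold m. generalize (Clog w). intros L.
    assert (h1 : Cexp ((a, m) * L) = (Cexp (a * L) * Cexp (Ci * (m * L)))%C).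
    { rewrite <- Cexp_plus. f_equal. destruct L.
      unfold Cplus, Cmult, RtoC; simpl; f_equal; ring. }
    assert (h2 : Cexp ((a, - m) * L) = (Cexp (a * L) * Cexp (- (Ci * (m * L))))%C).
    { rewrite <- Cexp_plus. f_equal. destruct L.
      unfold Cplus, Copp, Cmult, RtoC; simpl; f_equal; ring. }
    rewrite h1, h2. unfold Ccos, Csin. simpl Sc.
    destruct (Req_EM_T m 0) as [h0 | h0].
    + destruct (absVec_eq_0 a b c d h0) as (-> & -> & ->). rewrite h0.
      replace (Ci * (RtoC 0 * L))%C with (RtoC 0) by ring.
      replace (- RtoC 0)%C with (RtoC 0) by ring.
      unfold qmult, qscalar, minus, plus, opp, mult, zero; simpl.
      unfold plus, zero; simpl.
      rewrite !RtoC_mult.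
      apply (quat_eq (K := C)); field; exact hCi.
    + generalize (Cexp (Ci * (m * L))) (Cexp (- (Ci * (m * L)))) (Cexp (a * L)).
      intros P Q E. clear - h0 hCi.
      unfold qmult, qscalar, HRtoHC, Vec, minus, plus, opp, mult, zero; simpl.
      unfold plus, zero; simpl.
      rewrite ?RtoC_plus, ?RtoC_minus, ?RtoC_opp, ?RtoC_mult.
      apply (quat_eq (K := C)); field; auto.
Qed.

(** For a fixed vector, every component of [from_conj] is a linear combination of its last two
    arguments, and convergence is componentwise. *)
Lemma is_series_from_conj (b c d : C) (A B : nat -> C) (SA SB : C) :
  is_series (V := C_NormedModule) A SA -> is_series (V := C_NormedModule) B SB ->
  is_series (V := HC_NormedModule) (fun j => from_conj (b, c, d) (A j) (B j))
    (from_conj (b, c, d) SA SB).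
Proof.
  intros hA hB.
  assert (hlin : forall s t : C, is_series (V := C_NormedModule)
            (fun j => s * A j + t * B j)%C (s * SA + t * SB)%C).
  { intros s t. exact (is_series_plus _ _ _ _ (is_series_scal s _ _ hA)
      (is_series_scal t _ _ hB)). }
  pose proof Ci_neq_0 as hCi.
  assert (hcos : is_series (V := C_NormedModule)
            (fun j => (A j + B j) / 2)%C ((SA + SB) / 2)%C).
  { replace ((SA + SB) / 2)%C with (/ 2 * SA + / 2 * SB)%C by field.
    refine (is_series_ext (V := C_NormedModule) _ _ _ _ (hlin (/ 2) (/ 2))%C).
    intros j. change ((/ 2 * A j + / 2 * B j)%C = ((A j + B j) / 2)%C). field. }
  assert (hsin : forall s : C, is_series (V := C_NormedModule)
            (fun j => s * ((A j - B j) / (2 * Ci)))%C (s * ((SA - SB) / (2 * Ci)))%C).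
  { intros s. replace (s * ((SA - SB) / (2 * Ci)))%C
      with (s / (2 * Ci) * SA + - (s / (2 * Ci)) * SB)%C by now field.
    refine (is_series_ext (V := C_NormedModule) _ _ _ _
              (hlin (s / (2 * Ci)) (- (s / (2 * Ci))))%C).
    intros j.
    change ((s / (2 * Ci) * A j + - (s / (2 * Ci)) * B j)%C
            = (s * ((A j - B j) / (2 * Ci)))%C).
    now field. }
  exact (is_series_pair _ _ _ _ (is_series_pair _ _ _ _
    (is_series_pair _ _ _ _ hcos (hsin b)) (hsin c)) (hsin d)).
Qed.

Theorem theorem1 (q : HR) (z : C) (ha : 0 < Sc q) (hz : Cmod z <= 1) :
  is_series (V := HC_NormedModule)
    (fun j : nat => qmult (HRtoHC (qbinom q j)) (qscalar (Cpow z j)))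
    (Cqpow (1 + z)%C q).
Proof.
  destruct q as [[[a b] c] d]. simpl in ha.
  rewrite Cqpow_from_conj.
  eapply is_series_ext; [intros j; symmetry; apply qbinom_term |].
  apply is_series_from_conj; now apply is_series_Cbinom.
Qed.
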